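(* Let $V$ be a vector space over a field $\mathbf{k}$ (not necessarily finite dimensional), let $X$ be a collection of linear subspaces of $V$, and let $G$ be a group acting linearly on $V$ and preserving $X$ setwise (i.e. $g$ maps every member of $X$ to a member of $X$, for all $g\in G$). For $x\in X$ denote by $A_x\subset V$ the corresponding subspace. Assume that for some integer $r\ge 1$ one has $\dim A_x/(A_x\cap A_y)\le r$ for all $x,y\in X$. Then there exists a $G$-invariant subspace $W\subset V$, which is a finite sum of some finite intersections of subspaces from $X$, such that for every $x\in X$ $$\dim W/(W\cap A_x)\le r \quad\text{and}\quad \dim A_x/(W\cap A_x)\le r\cdot (r+1)^{r+1}.$$
   Context: Dimensions are over $\mathbf{k}$; an inequality $\dim U\le n$ includes the assertion that $U$ is finite dimensional. A subspace $W$ is $G$-invariant if $gW=W$ for all $g\in G$. The group $G$ and the collection $X$ may be infinite. *)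

(* Defs.v *)
From HB Require Import structures.
From mathcomp Require Import all_boot all_algebra.
From mathcomp Require Import generic_quotient ring_quotient.

Set Implicit Arguments.
Unset Strict Implicit.
Unset Printing Implicit Defensive.

Import GRing.Theory.
Local Open Scope quotient_scope.
Local Open Scope ring_scope.

(* A linear subspace of V is a [submodClosed V], a boolean predicate on V      *)
(* closed under the module operations; classically these are all subspaces.   *)

Section Dimension.
Variables (k : fieldType) (E : lmodType k).

Definition lin_free n (b : 'I_n -> E) : Prop :=
  forall c : 'I_n -> k, \sum_(i < n) c i *: b i = 0 -> forall i, c i = 0.

Definition lin_spanning n (b : 'I_n -> E) : Prop :=
  forall v : E, exists c : 'I_n -> k, v = \sum_(i < n) c i *: b i.

(* E need not be finite dimensional, so it is not a [vectType]. *)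
Definition dim_le (n : nat) : Prop :=
  exists m (b : 'I_m -> E), [/\ (m <= n)%N, lin_free b & lin_spanning b].

End Dimension.
Arguments dim_le {k} E n.

Section Subspaces.
Variables (k : fieldType) (V : lmodType k).
Implicit Types U W : submodClosed V.

Definition cap_sub U W : {pred V} := [predI U & W].

Lemma cap_sub_closed U W : submod_closed (cap_sub U W).
Proof.
split; first by rewrite !inE !rpred0.
move=> a u v; rewrite !inE => /andP[uU uW] /andP[vU vW].
by rewrite !rpredD ?rpredZ.
Qed.

HB.instance Definition _ U W :=
  GRing.isSubmodClosed.Build k V (cap_sub U W) (cap_sub_closed U W).

Definition sub_space U : Type := {v : V | v \in U}.

HB.instance Definition _ U := SubChoice.on (sub_space U).

Lemma sub_space_closed U : submod_closed (mem U).
Proof. by split=> [|a u v uU vU]; rewrite ?rpred0 ?rpredD ?rpredZ. Qed.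

HB.instance Definition _ U :=
  GRing.SubChoice_isSubLmodule.Build k V _ (sub_space U) (sub_space_closed U).

Definition trace_sub U W : {pred sub_space U} := [pred u | \val u \in W].

Arguments trace_sub : clear implicits.

Lemma trace_sub_closed U W : submod_closed (trace_sub U W).
Proof.
split=> [|a u v]; first by rewrite inE raddf0 rpred0.
by rewrite !inE => uW vW; rewrite linearP rpredD ?rpredZ.
Qed.

HB.instance Definition _ U W :=
  GRing.isSubmodClosed.Build k (sub_space U) (trace_sub U W)
    (trace_sub_closed U W).

End Subspaces.
Arguments cap_sub {k V} U W.
Arguments sub_space {k V} U.
Arguments trace_sub {k V} U W.

Section Quotient.
Variables (k : fieldType) (V : lmodType k) (U W : submodClosed V).

(* U / W, for W contained in U *)
Definition quot_space : Type := Quotient.quot (trace_sub U W).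

HB.instance Definition _ := GRing.Zmodule.on quot_space.

Definition quot_proj (u : sub_space U) : quot_space :=
  \pi_(Quotient.quot (trace_sub U W)) u.

Definition quot_scale (a : k) (x : quot_space) : quot_space :=
  quot_proj (a *: repr x).

Lemma quot_projP u v :
  (quot_proj u == quot_proj v) = (u - v \in trace_sub U W).
Proof. by rewrite /quot_proj -Quotient.idealrBE. Qed.

Lemma quot_projK x : quot_proj (repr x) = x.
Proof. exact: reprK. Qed.

Lemma quot_projD u v : quot_proj (u + v) = quot_proj u + quot_proj v.
Proof. by rewrite /quot_proj [LHS]raddfD. Qed.

Lemma quot_projZ a u : quot_proj (a *: u) = quot_scale a (quot_proj u).
Proof.
by apply/eqP; rewrite quot_projP -scalerBr rpredZ // -quot_projP quot_projK.
Qed.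

Lemma quot_scaleA a b x : quot_scale a (quot_scale b x) = quot_scale (a * b) x.
Proof. by rewrite -[x]quot_projK -!quot_projZ scalerA. Qed.

Lemma quot_scale1 : left_id 1 quot_scale.
Proof. by move=> x; rewrite /quot_scale scale1r quot_projK. Qed.

Lemma quot_scaleDr : right_distributive quot_scale +%R.
Proof.
move=> a x y; rewrite -[x]quot_projK -[y]quot_projK -quot_projD -!quot_projZ.
by rewrite scalerDr quot_projD.
Qed.

Lemma quot_scaleDl x : {morph quot_scale^~ x : a b / a + b}.
Proof. by move=> a b; rewrite /quot_scale scalerDl quot_projD. Qed.

HB.instance Definition _ :=
  GRing.Zmodule_isLmodule.Build k quot_space
    quot_scaleA quot_scale1 quot_scaleDr quot_scaleDl.

Lemma quot_proj_linear : linear quot_proj.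
Proof. by move=> a u v; rewrite quot_projD quot_projZ. Qed.

HB.instance Definition _ :=
  GRing.isLinear.Build k (sub_space U) quot_space *:%R quot_proj
    quot_proj_linear.

End Quotient.
Arguments quot_space {k V} U W.
Arguments quot_proj {k V} U W.

Section Statement.
Variables (k : fieldType) (V : lmodType k).

Definition linear_action (G : groupType) (rho : G -> {linear V -> V}) : Prop :=
  (forall v, rho 1%g v = v) /\
  (forall g h v, rho (g * h)%g v = rho g (rho h v)).

Definition maps_onto (f : V -> V) (U W : submodClosed V) : Prop :=
  forall v, v \in W <-> exists2 u, u \in U & f u = v.

(* The intersections are of nonempty families; the empty sum (n = 0) is the   *)
(* zero subspace.                                                             *)
Definition sum_of_intersections (X : Type) (A : X -> submodClosed V)
    (W : submodClosed V) : Prop :=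
  exists (n : nat) (m : 'I_n -> nat) (F : forall i, 'I_(m i).+1 -> X),
    forall v, v \in W <->
      exists w : 'I_n -> V,
        (forall i (j : 'I_(m i).+1), w i \in A (F i j)) /\
        v = \sum_(i < n) w i.

End Statement.

(* Main.v *)
(** Say that a finite intersection [B] of members of [X] is near for [d] if
[dim B/(B ∩ A_x) <= d] for all [x], and set [n_0 = 1],
[n_(i+1) = (r+1) n_i + 1], so that [r n_i + 1 = (r+1)^(i+1)].  By pigeonhole
there is [i <= r] such that, with [d = r - i], some intersection of at most
[n_i] members is near for [d], while every intersection [C] of at most
[n_(i+1)] members has [dim C/(C ∩ A_x) >= d] for some [x].  For such [C] and
[x], every near [B] containing [C] satisfies [B ⊆ C + A_x].

[W] is the sum of all intersections of at most [n_i] members that are near for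
[d].  If [r + 1] vectors [s_j] of such [B_j] were independent modulo [A_y],
take [C] to be the intersection of all [B_j] and [A_y]: then
[s_j ∈ C + A_x ⊆ A_y + A_x], contradicting [dim A_x/(A_x ∩ A_y) <= r].  Hence
[dim W/(W ∩ A_y) <= r].  As [W] contains an intersection [B] of [n_i] members,
[A_x/(A_x ∩ W)] has dimension at most [r n_i] and [W/B] has finite dimension,
so that finitely many of the summands suffice. *)

Require Import Defs.
From mathcomp Require Import all_boot all_algebra.
From HB Require Import structures.
From mathcomp Require Import boolp.

Set Implicit Arguments.
Unset Strict Implicit.
Unset Printing Implicit Defensive.

Import GRing.Theory.
Local Open Scope ring_scope.

(** * Independence and codimension modulo a subspace *)

Section RelativeDimension.
Variables (k : fieldType) (V : lmodType k).
Implicit Types (S : {pred V}) (T U W : submodClosed V).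

Definition indep_mod (T : {pred V}) m (b : 'I_m -> V) : Prop :=
  forall c : 'I_m -> k, \sum_(i < m) c i *: b i \in T -> forall i, c i = 0.

(** For subspaces this is dim S/(S ∩ T) <= n, stated without quotients. [S] may be any predicate, so
    that unions of subspaces are covered too. *)
Definition codim_le (S T : {pred V}) (n : nat) : Prop :=
  forall m (b : 'I_m -> V), (forall i, b i \in S) -> indep_mod T b -> (m <= n)%N.

Definition spans_mod (S T : {pred V}) m (b : 'I_m -> V) : Prop :=
  forall u, u \in S -> exists c : 'I_m -> k, u - \sum_(i < m) c i *: b i \in T.

Lemma in_cap_sub U T v : (v \in cap_sub U T) = (v \in U) && (v \in T).
Proof. by []. Qed.

(* The library's [rpredB] does not see [submodClosed V] as closed under
   subtraction. *)
Lemma submodB U : {in U &, forall u v, u - v \in U}.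
Proof. by move=> u v uU vU; rewrite -scaleN1r rpredD ?rpredZ. Qed.

Lemma codim_leW (S T : {pred V}) n n' :
  (n <= n')%N -> codim_le S T n -> codim_le S T n'.
Proof. by move=> le_nn' ST m b bS bT; apply: leq_trans le_nn'; apply: ST bT. Qed.

Lemma codim_leS (S S' T T' : {pred V}) n :
  {subset S' <= S} -> {subset T <= T'} -> codim_le S T n -> codim_le S' T' n.
Proof.
move=> S'S TT' ST m b bS bT; apply: ST (fun i => S'S _ (bS i)) _.
by move=> c cT; apply: bT; apply: TT'.
Qed.

Lemma codim_le_capl U T n : codim_le U T n <-> codim_le U (cap_sub T U) n.
Proof.
split=> UT; last by apply: codim_leS UT => // v; rewrite in_cap_sub => /andP[].
move=> m b bU bT; apply: UT (bU) _ => c cT; apply: bT.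
by rewrite in_cap_sub cT rpred_sum // => i _; rewrite rpredZ.
Qed.

Lemma codim_le_capr U T n : codim_le U T n <-> codim_le U (cap_sub U T) n.
Proof.
rewrite codim_le_capl; split; apply: codim_leS => // v;
  by rewrite !in_cap_sub andbC.
Qed.

Lemma indep_mod_widen (T : {pred V}) m n (le_nm : (n <= m)%N) (b : 'I_m -> V) :
  indep_mod T b -> indep_mod T (b \o widen_ord le_nm).
Proof.
move=> bT c cT i.
(* Extend [c] by zero beyond the first [n] indices. *)
pose c' (j : 'I_m) := if insub (val j) is Some i then c i else 0.
suff /bT/(_ (widen_ord le_nm i)) : \sum_(j < m) c' j *: b j \in T.
  by rewrite /c' /= valK.
suff -> : \sum_j c' j *: b j = \sum_i c i *: (b \o widen_ord le_nm) i by [].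
rewrite (bigID (fun j : 'I_m => (j < n)%N)) /= addrC big1 ?add0r; last first.
  by move=> j jn; rewrite /c' insubN ?scale0r.
rewrite big_ord_narrow; apply: eq_bigr => j _.
by rewrite /c' /= valK.
Qed.

(** For more than [m] vectors the coefficient matrix has a nonzero left kernel vector, which is a
    nontrivial relation modulo [T]. *)
Lemma spans_mod_codim_le S T m (b : 'I_m -> V) :
  spans_mod S T b -> codim_le S T m.
Proof.
move=> bS p w wS wT; rewrite leqNgt; apply/negP => lt_mp.
have /choice[c cP] : forall i, exists c : 'I_m -> k,
  w i - \sum_(j < m) c j *: b j \in T by move=> i; apply: bS.
pose M := \matrix_(i < p, j < m) c i j.
have /rowV0Pn[v /sub_kermxP vM] : kermx M != 0.
  rewrite kermx_eq0 /row_free; apply: contraTneq lt_mp => <-.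
  by rewrite -leqNgt rank_leq_col.
case/negP; apply/eqP/rowP => i; rewrite [RHS]mxE; move: i; apply: wT.
have -> : \sum_i v 0 i *: w i =
    \sum_i v 0 i *: (w i - \sum_(j < m) c i j *: b j).
  under [RHS]eq_bigr do rewrite scalerBr scaler_sumr.
  rewrite sumrB exchange_big /= [X in _ - X]big1 ?subr0 // => j _.
  under eq_bigr do rewrite scalerA.
  rewrite -scaler_suml; have := congr1 (fun A : 'rV_m => A 0 j) vM.
  by rewrite !mxE; under eq_bigr do rewrite mxE; move=> ->; rewrite scale0r.
by apply: rpred_sum => i _; rewrite rpredZ.
Qed.

(** By maximality of [m], adjoining [u] to [b] creates a relation modulo [T]. Independence of [b]
    makes its coefficient at [u] nonzero, so it can be solved for [u]. *)
Lemma indep_mod_spans S T m (b : 'I_m -> V) :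
    codim_le S T m -> (forall i, b i \in S) -> indep_mod T b ->
  spans_mod S T b.
Proof.
move=> ST bS bT u uS.
pose b' i := if unlift ord0 i is Some j then b j else u.
have b'E (c : 'I_m.+1 -> k) : \sum_i c i *: b' i =
    c ord0 *: u + \sum_i c (lift ord0 i) *: b i.
  rewrite big_ord_recl /b' unlift_none; congr (_ + _).
  by apply: eq_bigr => i _; rewrite liftK.
have [//|/existsNP[c]] := pselect (indep_mod T b').
  move=> b'T; suff : (m.+1 <= m)%N by rewrite ltnn.
  by apply: ST b'T => i; rewrite /b'; case: unliftP.
rewrite not_implyE b'E => -[cT /existsNP[i ci]].
have c0 : c ord0 != 0.
  apply: contra_notN ci => /eqP c0; rewrite c0 scale0r add0r in cT.
  by case: (unliftP ord0 i) => [j ->|-> //]; apply: (bT _ cT).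
exists (fun i => - ((c ord0)^-1 * c (lift ord0 i))).
have -> : u - \sum_i - ((c ord0)^-1 * c (lift ord0 i)) *: b i =
   (c ord0)^-1 *: (c ord0 *: u + \sum_i c (lift ord0 i) *: b i).
  rewrite scalerDr scalerA mulVf // scale1r scaler_sumr -sumrN.
  by congr (_ + _); apply: eq_bigr => j _; rewrite scaleNr opprK scalerA.
exact: rpredZ.
Qed.

Lemma exists_basis_mod S T n : codim_le S T n ->
  exists m (b : 'I_m -> V),
    [/\ (m <= n)%N, forall i, b i \in S, indep_mod T b & spans_mod S T b].
Proof.
move=> ST.
pose P m := `[< exists b : 'I_m -> V, (forall i, b i \in S) /\ indep_mod T b >].
have P0 : exists m, P m.
  by exists 0; apply/asboolP; exists (fun=> 0); split=> [[]|c _ []].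
have Pn m : P m -> (m <= n)%N by move=> /asboolP[b [bS bT]]; apply: ST bT.
case: (ex_maxnP P0 Pn) => m Pm max_m; case/asboolP: (Pm) => b [bS bT].
exists m, b; split=> //; first exact: Pn.
apply: indep_mod_spans => // p w wS wT.
by apply: max_m; apply/asboolP; exists w.
Qed.

(** A basis of [U] modulo [T], followed by one of U ∩ T modulo [W], spans [U] modulo T ∩ W. *)
Lemma codim_le_cap U T W m n :
  codim_le U T m -> codim_le U W n -> codim_le U (cap_sub T W) (m + n).
Proof.
move=> /exists_basis_mod[m' [b [le_m bU _ bs]]] UW.
have /exists_basis_mod[n' [b' [le_n b'U _ b's]]] : codim_le (cap_sub U T) W n.
  by apply: codim_leS UW => // v; rewrite in_cap_sub => /andP[].
apply: codim_leW (leq_add le_m le_n) _.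
apply: (@spans_mod_codim_le _ _ _
  (fun i => match split i with inl j => b j | inr j => b' j end)) => u uU.
have [c cT] := bs _ uU.
have /b's[c' c'W] : u - \sum_i c i *: b i \in cap_sub U T.
  by rewrite in_cap_sub cT andbT submodB // rpred_sum // => i _; rewrite rpredZ.
exists (fun i => match split i with inl j => c j | inr j => c' j end).
rewrite big_split_ord /=.
under eq_bigr do rewrite -[lshift _ _]/(unsplit (inl _)) unsplitK.
under [X in u - (_ + X)]eq_bigr do rewrite -[rshift _ _]/(unsplit (inr _)) unsplitK.
rewrite opprD addrA in_cap_sub c'W andbT submodB // rpred_sum // => i _.
by rewrite rpredZ //; have := b'U i; rewrite in_cap_sub => /andP[].
Qed.

(** [T] need not lie in [U], since the quotient is by the trace of [T] on [U]. *)
Lemma dim_le_quot_space U T n : dim_le (quot_space U T) n <-> codim_le U T n.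
Proof.
have qE m (c : 'I_m -> k) (b : 'I_m -> sub_space U) :
    \sum_i c i *: quot_proj U T (b i) = quot_proj U T (\sum_i c i *: b i).
  by rewrite linear_sum; apply: eq_bigr => i _; rewrite linearZ.
have vE m (c : 'I_m -> k) (b : 'I_m -> sub_space U) :
    \val (\sum_i c i *: b i) = \sum_i c i *: \val (b i).
  by rewrite raddf_sum; apply: eq_bigr => i _; apply: linearZZ.
split=> [[m [b [le_mn _ bs]]]|/exists_basis_mod[m [b [le_mn bU bT bs]]]].
  apply: codim_leW le_mn _.
  apply: (@spans_mod_codim_le _ _ _ (fun i => \val (repr (b i)))) => u uU.
  have [c cE] := bs (quot_proj U T (Sub u uU)); exists c.
  have /eqP := cE; under eq_bigr do rewrite -[b _]quot_projK.
  by rewrite qE quot_projP inE raddfB /= vE.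
pose b' i : sub_space U := Sub (b i) (bU i).
exists m, (fun i => quot_proj U T (b' i)); split=> // [c|v].
  rewrite qE -(raddf0 (quot_proj U T)) => /eqP.
  by rewrite quot_projP subr0 inE vE => /bT.
have [c cT] := bs _ (valP (repr v)); exists c.
rewrite qE -[LHS]quot_projK; apply/eqP.
by rewrite quot_projP inE raddfB /= vE.
Qed.

End RelativeDimension.

(** * Finite intersections and finite sums *)

Section Family.
Variables (k : fieldType) (V : lmodType k) (X : Type) (A : X -> submodClosed V).
Implicit Types (S : {pred V}) (T U : submodClosed V) (l : seq X).

(** The empty list gives all of [V]; hence the conditions [0 < size l] below. *)
Definition meet l : {pred V} := [pred v | all (fun x => v \in A x) l].

Lemma meet_closed l : submod_closed (meet l).
Proof.
split=> [|a u v]; rewrite !inE; first by elim: l => //= x l ->; rewrite rpred0.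
elim: l => //= x l IHl /andP[ux ul] /andP[vx vl].
by rewrite rpredD ?rpredZ //= IHl.
Qed.

HB.instance Definition _ l :=
  GRing.isSubmodClosed.Build k V (meet l) (meet_closed l).

Lemma codim_le_meet U l r :
  (forall x, codim_le U (A x) r) -> codim_le U (meet l) (size l * r).
Proof.
move=> Ur; elim: l => [|x l IHl] /=.
  apply: (@spans_mod_codim_le _ _ _ _ 0 (fun=> 0)) => u _.
  by exists (fun=> 0); rewrite inE.
have := codim_le_cap (Ur x) IHl.
by apply: codim_leS => // v; rewrite !inE.
Qed.

Definition finite_sums S : {pred V} :=
  [pred v | `[< exists2 s : seq V, {subset s <= S} & v = \sum_(u <- s) u >]].

Lemma finite_sumsP S v :
  reflect (exists2 s : seq V, {subset s <= S} & v = \sum_(u <- s) u)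
          (v \in finite_sums S).
Proof. exact: asboolP. Qed.

Lemma sub_finite_sums S : {subset S <= finite_sums S}.
Proof.
move=> u uS; apply/finite_sumsP; exists [:: u]; last by rewrite big_seq1.
by move=> v; rewrite inE => /eqP ->.
Qed.

Lemma finite_sums_closed S :
  (forall a, {in S, forall u, a *: u \in S}) -> submod_closed (finite_sums S).
Proof.
move=> SZ; split; first by apply/finite_sumsP; exists [::]; rewrite ?big_nil.
move=> a _ _ /finite_sumsP[s sS ->] /finite_sumsP[t tS ->].
apply/finite_sumsP; exists (map ( *:%R a) s ++ t).
  by move=> v; rewrite mem_cat => /orP[/mapP[u /sS uS ->]|/tS //]; apply: SZ.
by rewrite big_cat big_map /= scaler_sumr.
Qed.

Lemma finite_sums_sub S (P : {pred V}) :
    0 \in P -> {in P &, forall u v, u + v \in P} -> {subset S <= P} ->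
  {subset finite_sums S <= P}.
Proof.
move=> P0 PD SP _ /finite_sumsP[s sS ->].
by rewrite big_seq; apply: (big_ind (fun v => v \in P)) => // u /sS /SP.
Qed.

(** Vectors of [S] spanning [S] modulo [T] also span its sums. So a bound on a sum of subspaces can
    be tested on vectors of single summands. *)
Lemma codim_le_finite_sums S T n :
  codim_le S T n -> codim_le (finite_sums S) T n.
Proof.
move=> /exists_basis_mod[m [b [le_mn _ _ bS]]].
apply: codim_leW le_mn _; apply: (@spans_mod_codim_le _ _ _ _ _ b) => u uS.
pose P := [pred v | `[< exists c, v - \sum_(i < m) c i *: b i \in T >]].
suff /asboolP : u \in P by [].
apply: finite_sums_sub uS => [|v w /asboolP[c cT] /asboolP[c' c'T]|v vS].
- apply/asboolP; exists (fun=> 0); rewrite big1 ?subr0 ?rpred0 // => i _.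
  by rewrite scale0r.
- apply/asboolP; exists (fun i => c i + c' i).
  under eq_bigr do rewrite scalerDl.
  by rewrite big_split /= opprD addrACA rpredD.
- exact/asboolP/bS.
Qed.

(** * Near intersections and the pigeonhole on depths *)

Definition near_meet n d l : Prop :=
  (0 < size l <= n)%N /\ forall x, codim_le (meet l) (A x) d.

Definition tight n d : Prop :=
  forall l, (0 < size l <= n)%N ->
  exists x (b : 'I_d -> V), (forall i, b i \in meet l) /\ indep_mod (A x) b.

Lemma tight0 n : tight n 0.
Proof.
by case=> // x l _; exists x, (fun=> 0); split=> [[]|c _ []].
Qed.

Lemma not_tight_near n d : ~ tight n d.+1 -> exists l, near_meet n d l.
Proof.
move=> /existsNP[l]; rewrite not_implyE => -[ln nx]; exists l; split=> // x.
move=> m b bl bT; rewrite leqNgt; apply/negP => lt_dm; apply: nx.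
by exists x, (b \o widen_ord lt_dm); split; [move=> i /= | apply: indep_mod_widen].
Qed.

(** These are the n_i: the next depth leaves room for [r.+1] intersections of the previous depth and
    one more member. *)
Fixpoint depth r i : nat := if i is j.+1 then (r.+1 * depth r j).+1 else 1.

Lemma depthE r i : (r * depth r i).+1 = (r.+1 ^ i.+1)%N.
Proof.
elim: i => [|i IHi] /=; first by rewrite muln1.
by rewrite mulnS mulnCA expnS -IHi mulnS addSn.
Qed.

(** If no [i] worked, each failure of tightness would yield a near intersection at the next level,
    up to level [r], where tightness for 0 is trivial. *)
Lemma exists_tight_depth (x0 : X) r :
    (forall x y, codim_le (A x) (A y) r) ->
  exists i, [/\ (i <= r)%N, tight (depth r i.+1) (r - i)
              & exists l, near_meet (depth r i) (r - i) l].
Proof.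
move=> Ar; apply: contrapT => /forallNP noi.
have near i : (i <= r)%N -> exists l, near_meet (depth r i) (r - i) l.
  elim: i => [_|i IHi lt_ir].
    exists [:: x0]; split=> // x; rewrite subn0.
    by apply: codim_leS (Ar x0 x) => // v; rewrite inE /= andbT.
  apply: not_tight_near; rewrite subnSK // => ti.
  by apply: (noi i); split=> //; [apply: ltnW | apply/IHi/ltnW].
apply: (noi r); split=> //; last exact: near.
by rewrite subnn; apply: tight0.
Qed.

(** * The subspace [W] *)

Definition near_union n d : {pred V} :=
  [pred v | `[< exists2 l, near_meet n d l & v \in meet l >]].

Lemma near_unionP n d v :
  reflect (exists2 l, near_meet n d l & v \in meet l) (v \in near_union n d).
Proof. exact: asboolP. Qed.

(** Taking all near intersections, with no choice among them, is what makes this subspace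
    invariant. *)
Definition core n d : {pred V} := finite_sums (near_union n d).

Lemma core_closed n d : submod_closed (core n d).
Proof.
apply: finite_sums_closed => a u /near_unionP[l ln ul].
by apply/near_unionP; exists l; rewrite ?rpredZ.
Qed.

HB.instance Definition _ n d :=
  GRing.isSubmodClosed.Build k V (core n d) (core_closed n d).

Lemma sub_meet_core n d l : near_meet n d l -> {subset meet l <= core n d}.
Proof.
by move=> ln u ul; apply/sub_finite_sums/near_unionP; exists l.
Qed.

Lemma codim_le_core n d r x :
    (forall x y, codim_le (A x) (A y) r) -> tight (r.+1 * n).+1 d ->
  codim_le (core n d) (A x) r.
Proof.
move=> Ar nd; apply: codim_le_finite_sums => m s0 s0S s0T.
rewrite leqNgt; apply/negP => lt_rm.
(* Keep exactly [r.+1] vectors, so that [l'] below has at most [(r.+1 * n).+1] members. *)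
pose s := s0 \o widen_ord lt_rm.
have sS i : s i \in near_union n d by apply: s0S.
have sT : indep_mod (A x) s by apply: indep_mod_widen.
have /choice[l lP] : forall i, exists l, near_meet n d l /\ s i \in meet l.
  by move=> i; have /near_unionP[l] := sS i; exists l.
pose l' := x :: flatten [seq l i | i <- enum 'I_r.+1].
have /nd[y [b [bl' by_]]] : (0 < size l' <= (r.+1 * n).+1)%N.
  rewrite /= ltnS size_flatten sumnE /shape -map_comp big_map big_enum /=.
  rewrite -[r.+1 in leqRHS]card_ord -sum_nat_const leq_sum // => i _.
  by have [[/andP[]]] := lP i.
have l'x v : v \in meet l' -> v \in A x by rewrite inE => /andP[].
have l'l i v : v \in meet l' -> v \in meet (l i).
  rewrite !inE /= => /andP[_]; have := mem_enum 'I_r.+1 i.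
  elim: (enum _) => //= j e IHe; rewrite in_cons all_cat.
  by move=> /predU1P[<-|/IHe ie] /andP[] // _ /ie.
(* The [d] independent vectors [b] lie in [meet (l i)], whose codimension modulo [A y] is at most
   [d]; so they span it modulo [A y]. *)
have /choice[c cP] : forall i, exists c : 'I_d -> k,
    s i - \sum_j c j *: b j \in A y.
  move=> i; have [[_ ld] si] := lP i.
  by apply: (indep_mod_spans (ld y)) si => // j; apply: l'l.
suff : (r.+1 <= r)%N by rewrite ltnn.
(* The corrected vectors lie in [A y], and stay independent modulo [A x] because the corrections lie
   in [meet l'], inside [A x]. *)
apply: (Ar y x _ (fun i => s i - \sum_j c i j *: b j)) => // a aT.
apply: sT; rewrite -[X in X \in _](subrK (\sum_i a i *: \sum_j c i j *: b j)).
rewrite rpredD //.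
  rewrite -sumrB; under eq_bigr do rewrite -scalerBr; exact: aT.
by rewrite !(rpred_sum, rpredZ) // => i _; rewrite rpredZ // rpred_sum // => j _;
  rewrite rpredZ // l'x.
Qed.

Lemma codim_le_inv_core n d r x :
    (forall x y, codim_le (A x) (A y) r) -> (exists l, near_meet n d l) ->
  codim_le (A x) (core n d) (n * r).
Proof.
move=> Ar [l ln]; have [/andP[_ le_ln] _] := ln.
apply: codim_leW (leq_mul le_ln (leqnn r)) _.
exact: codim_leS (sub_meet_core ln) (codim_le_meet (Ar x)).
Qed.

Lemma sum_of_intersections_core n d r :
    (forall x, codim_le (core n d) (A x) r) -> (exists l, near_meet n d l) ->
  sum_of_intersections A (core n d).
Proof.
move=> Wr [l0 l0n].
(* The basis is drawn from [near_union], so that each vector lies in a single near intersection. *)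
have /exists_basis_mod[m [b [_ bS _ bs]]] :
    codim_le (near_union n d) (meet l0) (size l0 * r).
  apply: codim_leS (codim_le_meet Wr) => //; exact: sub_finite_sums.
have /choice[l lP] : forall i, exists l, near_meet n d l /\ b i \in meet l.
  by move=> i; have /near_unionP[l] := bS i; exists l.
pose L (i : 'I_m.+1) := if unlift ord0 i is Some j then l j else l0.
have Ln i : near_meet n d (L i).
  by rewrite /L; case: unliftP => // j _; have [] := lP j.
(* [x0] only serves as the default value of [nth]. *)
have [x0 _] : exists x0 : X, True.
  by case: (l0) l0n => [[]|x0 _ _] //; exists x0.
have LP w i : w \in meet (L i) <->
    (forall j : 'I_(size (L i)).-1.+1, w \in A (nth x0 (L i) j)).
  have [/andP[L_gt0 _] _] := Ln i.
  rewrite inE; split=> [/(all_nthP x0) wL j|wL].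
    by apply: wL; apply: leq_trans (ltn_ord j) _; rewrite prednK.
  apply/(all_nthP x0) => j; rewrite -(prednK L_gt0) => jL.
  exact: (wL (Ordinal jL)).
exists m.+1, (fun i => (size (L i)).-1), (fun i j => nth x0 (L i) j) => v.
split=> [vW|[w [wL ->]]]; last first.
  by rewrite rpred_sum // => i _; apply: (sub_meet_core (Ln i)); apply/LP.
pose P := [pred v | `[< exists w : 'I_m.+1 -> V,
  (forall i, w i \in meet (L i)) /\ v = \sum_i w i >]].
suff /asboolP[w [wL vE]] : v \in P.
  by exists w; split=> // i; apply/LP.
apply: finite_sums_sub vW => [|_ _ /asboolP[w [wL ->]] /asboolP[w' [w'L ->]]|u].
- by apply/asboolP; exists (fun=> 0); split=> [i|]; rewrite ?rpred0 ?big1.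
- apply/asboolP; exists (fun i => w i + w' i); rewrite big_split; split=> // i.
  by rewrite rpredD.
move=> /bs[c cl0]; apply/asboolP.
(* The remainder modulo the basis goes to the summand of [l0], which has index 0. *)
exists (fun i => if unlift ord0 i is Some j then c j *: b j
                 else u - \sum_j c j *: b j); split=> [i|].
  by rewrite /L; case: unliftP => // j _; rewrite rpredZ //; have [] := lP j.
rewrite big_ord_recl unlift_none; under [X in _ + X]eq_bigr do rewrite liftK.
by rewrite subrK.
Qed.

(** * Invariance under the group *)

Section Action.
Variables (G : groupType) (rho : G -> {linear V -> V}).
Hypothesis rhoP : linear_action rho.
Hypothesis rhoA : forall g x, exists y, maps_onto (rho g) (A x) (A y).

Lemma linear_actionK g : cancel (rho g) (rho g^-1%g).
Proof. by move=> v; rewrite -(proj2 rhoP) mulVg (proj1 rhoP). Qed.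

Lemma linear_actionVK g : cancel (rho g^-1%g) (rho g).
Proof. by move=> v; rewrite -(proj2 rhoP) mulgV (proj1 rhoP). Qed.

(** [rho g] carries [meet l] onto the intersection of the image members; nearness is checked by
    pulling independent families back along the inverse of [g]. *)
Lemma near_union_stable n d g v :
  v \in near_union n d -> rho g v \in near_union n d.
Proof.
move=> /near_unionP[l [ln ld] vl].
have /choice[f fP] := rhoA g.
have meet_f u : (rho g u \in meet (map f l)) = (u \in meet l).
  rewrite !inE all_map; apply: eq_all => x /=.
  apply/idP/idP => [/fP[w wx /(can_inj (linear_actionK g)) <- //]|ux].
  by apply/fP; exists u.
apply/near_unionP; exists (map f l); last by rewrite meet_f.
split=> [|x m b bl bx]; first by rewrite size_map.
have [y yP] := rhoA g^-1%g x.
apply: (ld y _ (fun i => rho g^-1%g (b i))).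
  by move=> i; rewrite -meet_f linear_actionVK.
move=> c; have -> : \sum_i c i *: rho g^-1%g (b i) =
    rho g^-1%g (\sum_i c i *: b i).
  by rewrite linear_sum; apply: eq_bigr => i _; rewrite linearZ.
by move=> /yP[u ux /(can_inj (linear_actionVK g)) uE]; apply: bx; rewrite -uE.
Qed.

Lemma core_invariant n d g : maps_onto (rho g) (core n d) (core n d).
Proof.
have stable h v : v \in core n d -> rho h v \in core n d.
  move=> /finite_sumsP[s sS ->]; rewrite linear_sum big_seq rpred_sum // => u /sS uS.
  exact/sub_finite_sums/near_union_stable.
move=> v; split=> [vW|[u uW <-]]; last exact: stable.
by exists (rho g^-1%g v); [apply: stable | rewrite linear_actionVK].
Qed.

End Action.
End Family.

Theorem theoremA (k : fieldType) (V : lmodType k)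
    (X : Type) (A : X -> submodClosed V)
    (G : groupType) (rho : G -> {linear V -> V})
    (hrho : linear_action rho)
    (hX : forall (g : G) (x : X), exists y : X, maps_onto (rho g) (A x) (A y))
    (r : nat) (hr : (1 <= r)%N)
    (hA : forall x y : X, dim_le (quot_space (A x) (cap_sub (A x) (A y))) r) :
  exists W : submodClosed V,
    [/\ forall g : G, maps_onto (rho g) W W,
        sum_of_intersections A W
      & forall x : X,
          dim_le (quot_space W (cap_sub W (A x))) r /\
          dim_le (quot_space (A x) (cap_sub W (A x)))
                 (r * (r + 1) ^ (r + 1))%N ].
Proof.
have Ar x y : codim_le (A x) (A y) r.
  exact/codim_le_capr/dim_le_quot_space/hA.
(* If [X] is empty there are no near intersections: [core] is zero, the empty sum, for any
   parameters. *)
have [[x0 _]|noX] := pselect (exists x : X, True); last first.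
  have no_near l : ~ near_meet A 1 0 l.
    by case: l => [[]//|x l _]; apply: noX; exists x.
  have W0 v : (v \in core A 1 0) = (v == 0).
    apply/idP/eqP => [|->]; last exact: rpred0.
    have sub0 : {subset near_union A 1 0 <= pred1 (0 : V)}.
      by move=> u /near_unionP[l /no_near].
    move=> vW; apply/eqP; apply: finite_sums_sub sub0 _ vW.
      by rewrite inE.
    by move=> u w /eqP -> /eqP ->; rewrite addr0 inE.
  exists (core A 1 0 : submodClosed V); split=> [g||x]; first exact: core_invariant.
    have F (i : 'I_0) : 'I_1 -> X by case: i.
    exists 0%N, (fun=> 0%N), F => v.
    rewrite W0; split=> [/eqP ->|[w [_ ->]]]; last by rewrite big_ord0.
    by exists (fun=> 0); split=> [[]|]; rewrite ?big_ord0.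
  by case: noX; exists x.
have [i [le_ir ti near_i]] := exists_tight_depth x0 Ar.
have Wr x := codim_le_core (x := x) Ar ti.
exists (core A (depth r i) (r - i) : submodClosed V); split=> [g||x].
- exact: core_invariant.
- exact: sum_of_intersections_core Wr near_i.
split; apply/dim_le_quot_space; first exact: (iffLR (codim_le_capr _ _ _)).
apply: (iffLR (codim_le_capl _ _ _));
  apply: codim_leW (codim_le_inv_core Ar near_i).
(* r n_i < (r+1)^(i+1) <= (r+1)^(r+1) <= r (r+1)^(r+1), the last step by r >= 1. *)
rewrite mulnC -ltnS depthE addn1; apply: leq_trans (_ : r.+1 ^ r.+1 <= _)%N.
  by rewrite leq_pexp2l.
by rewrite ltnW // ltnS leq_pmull.
Qed.
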